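(* Fix $T>0$. There exist positive constants $C_1,C_2$ such that $$C_1|t-s|^{1/2}\le E|F(t)-F(s)|^2\le C_2|t-s|^{1/2}$$ for all $s,t\in[0,T]$.
   Context: Fix $\alpha\in(0,1)$. Let $B=\{B(t):t\ge 0\}$ be a one-dimensional Brownian motion with random initial position, i.e. $B(t)=B(0)+W(t)$ with $W$ a standard Brownian motion started at $0$ and independent of $B(0)$. Assume $B(0)$ has a density $f\in C^\infty(\mathbb{R})$ that is a Schwartz function, i.e. $\sup_{x\in\mathbb{R}}(1+|x|^n)|f^{(m)}(x)|<\infty$ for all nonnegative integers $n,m$. Assume that $f(x)\,dx$ has a unique $\alpha$-quantile $q(0)$ (i.e. a unique number with $\int_{-\infty}^{q(0)}f(x)\,dx=\alpha$) and that $f(q(0))>0$. Let $u(x,t)$ denote the density of $B(t)$ (so $u(x,0)=f(x)$), and for $t>0$ let $q(t)$ be the (unique) $\alpha$-quantile of the law of $B(t)$. $F=\{F(t):t\ge 0\}$ is a centered Gaussian process (with continuous paths) with covariance function $$\rho(s,t)=E[F(s)F(t)]=\frac{P(B(s)\le q(s),\,B(t)\le q(t))-\alpha^2}{u(q(s),s)\,u(q(t),t)}.$$ *)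

(* Defs.v *)
From HB Require Import structures.
From mathcomp Require Export all_boot all_order all_algebra.
From mathcomp Require Export all_classical all_reals all_analysis.
Set Implicit Arguments.
Unset Strict Implicit.
Unset Printing Implicit Defensive.
Import Order.TTheory GRing.Theory Num.Theory.
Import numFieldNormedType.Exports.

Local Open Scope classical_set_scope.
Local Open Scope ring_scope.

(* Stochastic processes indexed by t >= 0 are represented by families indexed
   by all of R; every condition below is restricted to nonnegative times, and
   the values at negative times are irrelevant. *)

Definition schwartz (R : realType) (f : R -> R) : Prop :=
  (forall (m : nat) (x : R), derivable (derive1n m f) x 1) /\
  (forall n m : nat, exists M : R,
     forall x : R, (1 + `|x| ^+ n) * `|derive1n m f x| <= M).

Definition has_density d (T : measurableType d) (R : realType)
    (P : probability T R) (X : {RV P >-> R}) (g : R -> R) : Prop :=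
  [/\ measurable_fun setT g,
      (forall x, 0 <= g x)
    & forall A : set R, measurable A ->
        distribution P X A = (\int[lebesgue_measure]_(x in A) (g x)%:E)%E].

(* The product rule for subfamilies is the case where some A i are setT. *)
Definition mutually_independent d (T : measurableType d) (R : realType)
    (P : probability T R) (n : nat) (X : 'I_n -> T -> R) : Prop :=
  forall A : 'I_n -> set R, (forall i, measurable (A i)) ->
    P (\bigcap_(i in setT) (X i @^-1` A i)) =
    (\prod_(i < n) P (X i @^-1` A i))%E.

Definition process_sigma_algebra d (T : measurableType d) (R : realType)
    (P : probability T R) (X : R -> {RV P >-> R}) : set (set T) :=
  <<s \bigcup_(t in [set t : R | 0 <= t])
        preimage_set_system setT (X t) measurable >>.

Definition continuous_paths d (T : measurableType d) (R : realType)
    (P : probability T R) (X : R -> {RV P >-> R}) : Prop :=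
  {ae P, forall w, {within `[0, +oo[, continuous (fun t : R => X t w)}}.

Record standard_brownian_motion d (T : measurableType d) (R : realType)
    (P : probability T R) (W : R -> {RV P >-> R}) : Prop := {
  bm_start : {ae P, forall w, W 0 w = 0} ;
  bm_paths : continuous_paths W ;
  bm_increment : forall s t : R, 0 <= s -> s < t ->
    forall A : set R, measurable A ->
      P ((fun w => W t w - W s w) @^-1` A) =
      normal_prob 0 (Num.sqrt (t - s)) A ;
  bm_indep : forall (n : nat) (t : nat -> R),
    0 <= t 0%N -> nondecreasing_seq t ->
    mutually_independent P
      (fun (i : 'I_n) (w : T) => W (t i.+1) w - W (t i) w) }.

Record brownian_motion_random_start d (T : measurableType d) (R : realType)
    (P : probability T R) (B W : R -> {RV P >-> R}) : Prop := {
  bmr_W : standard_brownian_motion W ;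
  bmr_sum : forall (t : R) (w : T), 0 <= t -> B t w = B 0 w + W t w ;
  bmr_indep : forall E D : set T,
    process_sigma_algebra W E -> g_sigma_algebra_preimage (B 0) D ->
    P (E `&` D) = (P E * P D)%E }.

(* normal_prob takes a standard deviation, and for standard deviation 0 it is
   not a Dirac mass; degenerate Gaussians are therefore treated separately. *)
Definition gaussian_rv d (T : measurableType d) (R : realType)
    (P : probability T R) (X : T -> R) : Prop :=
  exists m s : R, 0 <= s /\
    forall A : set R, measurable A ->
      P (X @^-1` A) = if s == 0 then (\d_m A)%E else normal_prob m s A.

Definition gaussian_process d (T : measurableType d) (R : realType)
    (P : probability T R) (X : R -> {RV P >-> R}) : Prop :=
  forall (n : nat) (a t : 'I_n -> R), (forall i, 0 <= t i) ->
    gaussian_rv P (fun w : T => \sum_(i < n) a i * X (t i) w).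

Record centered_gaussian_process_cov d (T : measurableType d) (R : realType)
    (P : probability T R) (X : R -> {RV P >-> R}) (rho : R -> R -> R)
    : Prop := {
  cgp_gaussian : gaussian_process X ;
  cgp_centered : forall t : R, 0 <= t -> ('E_P[X t] = 0)%E ;
  cgp_cov : forall s t : R, 0 <= s -> 0 <= t ->
    ('E_P[fun w : T => (X s w * X t w)%R] = (rho s t)%:E)%E }.

Definition quantile_cov d (T : measurableType d) (R : realType)
    (P : probability T R) (B : R -> {RV P >-> R}) (alpha : R)
    (u : R -> R -> R) (q : R -> R) (s t : R) : R :=
  (fine (P [set w | B s w <= q s /\ B t w <= q t]) - alpha ^+ 2) /
  (u (q s) s * u (q t) t).

(* Main.v *)
From HB Require Import structures.
Require Import Defs.
From mathcomp Require Import all_boot all_order all_algebra.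
From mathcomp Require Import all_classical all_reals all_analysis.
From mathcomp Require Import measurable_realfun.
From mathcomp Require Import ring lra.
Import Order.TTheory GRing.Theory Num.Theory.
Import numFieldNormedType.Exports.
Local Open Scope classical_set_scope.
Local Open Scope ring_scope.
Set Implicit Arguments.
Unset Strict Implicit.
Unset Printing Implicit Defensive.

(** By its covariance, F has the same second moments as the process
    (1{B(t) <= q(t)} - alpha) / u(q(t), t).  With us and ut the densities at
    the two quantiles and, for s < t,
      de = P(B(s) <= q(s), q(t) < B(t))
    the probability of crossing the quantile curve upwards, this gives
      E|F(t) - F(s)|^2
        = (alpha - alpha^2) ((ut - us) / (us ut))^2 + 2 de / (us ut).
    The theorem holds because us and ut stay between two positive constants,
    ut - us is O(sqrt(t - s)), so that its square is negligible, and de is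
    exactly of order sqrt(t - s).

    All estimates come from one identity, [rcdf_evolution]: the distribution
    function of B(t) is the average of the translates, by v, of that of B(s),
    where v follows the law of W(t) - W(s), whose first absolute moment is at
    most 2 sqrt(t - s).  Bounds on the increments of the distribution function,
    and on the differences of two such increments, survive averaging; hence
    the density stays bounded by M and L-Lipschitz in space for the constants
    M and L of f ([density_le], [density_lip]).  Comparing an average with the
    function averaged shows that distribution function and density move by
    O(sqrt(t - s)) in time ([cdf_time_dist], [density_time_dist]).

    The density at the quantile is bounded below ([quantile_density_pos]): for
    small t because q(t) is close to q(0), where f is positive, and for larger
    t because the increments spread the mass around q(0) over bounded sets.
    The distribution function therefore has a slope bounded below at q(t), and
    since it moves by O(sqrt(t - s)) in time, so does the quantile
    ([quantile_holder]).  Finally, a crossing with increment v forces B(s) into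
    an interval of length at most |q(t) - q(s)| + |v|, which bounds de from
    above.  From below, it is enough that B(s) lies within sqrt(t - s) below
    q(s), which has a probability of order sqrt(t - s), and that the
    independent increment is between two fixed multiples of sqrt(t - s), which
    has a probability that does not depend on s and t. *)

(** * Gaussian increments *)

Section gaussian.
Context {R : realType}.
Notation mu := (@lebesgue_measure R).

(** The Radon-Nikodym derivative of the normal law agrees almost everywhere with
    the explicit density, since both integrate to the law on every Borel set. *)
Lemma ge0_integral_normal_prob (m s : R) (g : R -> \bar R) :
  (forall x, 0 <= g x)%E -> measurable_fun setT g ->
  (\int[normal_prob m s]_x g x = \int[mu]_x (g x * (normal_pdf m s x)%:E))%E.
Proof.
move=> g0 mg; have dom := normal_prob_dominates m s.
rewrite -(Radon_Nikodym_SigmaFinite.change_of_variables dom)//.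
have mRN := Radon_Nikodym_SigmaFinite.f_integrable dom.
apply: ae_eq_integral => //.
- by apply: emeasurable_funM => //; exact: measurable_int mRN.
- apply: emeasurable_funM => //; apply/measurable_EFinP.
  exact: measurable_normal_pdf.
- apply: ae_eqe_mul2l; apply: integral_ae_eq => //.
  + by apply/measurable_EFinP; exact: measurable_normal_pdf.
  + by move=> E _ mE; rewrite -Radon_Nikodym_SigmaFinite.f_integral.
Qed.

Lemma normal_peakM (c s : R) : 0 < c ->
  normal_peak (c * s) = c^-1 * normal_peak s.
Proof.
move=> c0; rewrite /normal_peak exprMn -mulrA -mulrnAr sqrtrM ?sqr_ge0//.
by rewrite sqrtr_sqr gtr0_norm// invfM.
Qed.

Lemma normr_le_expR_sqr (x : R) : `|x| <= expR (x ^+ 2 / 4).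
Proof.
apply: (le_trans _ (expR_ge1Dx _)).
rewrite -(real_normK (num_real x)); have := sqr_ge0 (`|x| - 2); nra.
Qed.

(** The factor |v| is absorbed by doubling the standard deviation, because
    |z| <= exp (z^2 / 4).  The first absolute moment is thus controlled by the
    total mass of another normal density. *)
Lemma normr_normal_pdf_le (s v : R) : 0 < s ->
  `|v| * normal_pdf 0 s v <= 2 * s * normal_pdf 0 (2 * s) v.
Proof.
move=> s0; have s20 : 0 < 2 * s by rewrite mulr_gt0.
rewrite !normal_pdfE ?gt_eqF// normal_peakM// /normal_fun !subr0.
have -> : 2 * s * (2^-1 * normal_peak s * expR (- v ^+ 2 / ((2 * s) ^+ 2 *+ 2)))
  = normal_peak s * (s * expR (- v ^+ 2 / ((2 * s) ^+ 2 *+ 2))) by field.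
rewrite mulrCA ler_pM2l ?normal_peak_gt0 ?gt_eqF// -ler_pdivrMl//.
rewrite mulrA -ler_pdivlMr ?expR_gt0// -expRB.
rewrite -[X in X * _ <= _]gtr0_norm ?invr_gt0// -normrM.
apply: (le_trans (normr_le_expR_sqr _)); rewrite ler_expR.
have -> : - v ^+ 2 / ((2 * s) ^+ 2 *+ 2) - - v ^+ 2 / (s ^+ 2 *+ 2) =
  (s^-1 * v) ^+ 2 * (3 / 8) by field; rewrite gt_eqF.
by rewrite ler_wpM2l ?sqr_ge0//; lra.
Qed.

Lemma normal_abs_moment_le (s : R) : 0 < s ->
  (\int[normal_prob 0 s]_v `|v|%:E <= (2 * s)%:E)%E.
Proof.
move=> s0; rewrite ge0_integral_normal_prob//; last first.
  by apply/measurable_EFinP; exact: normr_measurable.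
apply: (@le_trans _ _
  (\int[mu]_v ((2 * s)%:E * (normal_pdf 0 (2 * s) v)%:E))%E).
  apply: ge0_le_integral => //.
  - by move=> x _; rewrite mule_ge0// lee_fin normal_pdf_ge0.
  - apply: emeasurable_funM; apply/measurable_EFinP => //.
    exact: measurable_normal_pdf.
  - apply: emeasurable_funM => //; apply/measurable_EFinP.
    exact: measurable_normal_pdf.
  - by move=> x _; rewrite -!EFinM lee_fin normr_normal_pdf_le.
rewrite ge0_integralZl//.
- by rewrite integral_normal_pdf mule1.
- by apply/measurable_EFinP; exact: measurable_normal_pdf.
- by move=> x _; rewrite lee_fin normal_pdf_ge0.
- by rewrite lee_fin mulr_ge0// ltW.
Qed.

(** On the interval the density is at least its value at distance c from 0. *)
Lemma normal_prob_itv_ge (s a b c : R) : 0 < s -> a <= b ->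
  (forall v, a <= v <= b -> `|v| <= c) ->
  (((b - a) * (normal_peak s * expR (- c ^+ 2 / (s ^+ 2 *+ 2))))%:E
    <= normal_prob 0 s `[a, b])%E.
Proof.
move=> s0 ab abc; set k := normal_peak s * _.
have k0 : 0 <= k by rewrite mulr_ge0 ?normal_peak_ge0 ?expR_ge0.
rewrite /normal_prob.
apply: (@le_trans _ _ (\int[mu]_(x in `[a, b]) k%:E)%E).
  rewrite integral_cst//= lebesgue_measure_itv/= lte_fin.
  case: ltgtP ab => // [ab _|-> _]; first by rewrite -EFinD -EFinM mulrC.
  by rewrite subrr mul0r mule0.
apply: ge0_le_integral => //.
- apply/measurable_EFinP/measurable_funTS; exact: measurable_normal_pdf.
- move=> x /=; rewrite in_itv/= => /abc xc.
  rewrite lee_fin normal_pdfE ?gt_eqF// ler_wpM2l ?normal_peak_ge0//.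
  rewrite /normal_fun subr0 ler_expR !mulNr lerN2.
  rewrite ler_wpM2r ?invr_ge0 ?mulrn_wge0 ?sqr_ge0//.
  by rewrite -(real_normK (num_real x)) lerXn2r// nnegrE ?(le_trans _ xc).
Qed.
End gaussian.

(** * Independence of the present position and the next increment *)

Section independent_pair.
Context d (Omega : measurableType d) (R : realType) (P : probability Omega R).
Context d1 d2 (T1 : measurableType d1) (T2 : measurableType d2).
Variables (X : {mfun Omega >-> T1}) (Y : {mfun Omega >-> T2}).
Hypothesis XY_indep : forall A C, measurable A -> measurable C ->
  P (X @^-1` A `&` Y @^-1` C) = (P (X @^-1` A) * P (Y @^-1` C))%E.

(** A finite measure on a product is determined by its values on rectangles. *)
Lemma independent_pair_law (E : set (T1 * T2)) : measurable E ->
  P ((fun w => (X w, Y w)) @^-1` E) =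
  (distribution P X \x distribution P Y)%E E.
Proof.
move=> mE; have mXY : measurable_fun setT (fun w => (X w, Y w)).
  exact: measurable_fun_pair.
pose XYm := isMeasurableFun.Build _ _ _ _ (fun w => (X w, Y w)) mXY.
pose XY : {mfun Omega >-> (T1 * T2)%type} := HB.pack (fun w => (X w, Y w)) XYm.
rewrite (@product_measure_unique _ _ _ _ _ (distribution P X) (distribution P Y)
  (distribution P XY))//.
Qed.

Lemma independent_pair_fubini1 (E : set (T1 * T2)) : measurable E ->
  P ((fun w => (X w, Y w)) @^-1` E) =
  (\int[distribution P X]_x P (Y @^-1` xsection E x))%E.
Proof. by move=> mE; rewrite independent_pair_law. Qed.

Lemma independent_pair_fubini2 (E : set (T1 * T2)) : measurable E ->
  P ((fun w => (X w, Y w)) @^-1` E) =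
  (\int[distribution P Y]_y P (X @^-1` ysection E y))%E.
Proof.
move=> mE; rewrite independent_pair_law//.
rewrite (@product_measure_unique _ _ _ _ _ _ _
  (distribution P X \x^ distribution P Y)%E)// => A C mA mC.
by rewrite /= product_measure2E.
Qed.

End independent_pair.

Section brownian.
Context d (Omega : measurableType d) (R : realType) (P : probability Omega R).
Variables B W : R -> {RV P >-> R}.
Hypothesis hB : brownian_motion_random_start B W.

(** The relation B t = B 0 + W t, taken at t = 0, makes W 0 vanish everywhere
    and not just almost surely. *)
Lemma brownian_driver0 w : W 0 w = 0.
Proof. by apply: (@addrI _ (B 0 w)); rewrite -(bmr_sum hB) ?addr0. Qed.

(** Measurability is meant for the sigma-algebra generated by the driver: it is
    what lets the independence of B 0 apply to events on several W t at once. *)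
Lemma measurable_driver (t : R) : 0 <= t ->
  measurable_fun setT (W t : g_sigma_algebraType
    (\bigcup_(t in [set t : R | 0 <= t])
        preimage_set_system setT (W t) measurable) -> R).
Proof.
by move=> t0 _ Y mY; apply: sub_sigma_algebra; exists t => //; exists Y.
Qed.

Lemma start_indep_driver_pair (s t : R) (A : set R) (E : set (R * R)) :
  0 <= s -> s < t -> measurable A -> measurable E ->
  P (B 0 @^-1` A `&` (fun w => (W s w, (W t \- W s) w)) @^-1` E) =
  (P (B 0 @^-1` A) * P ((fun w => (W s w, (W t \- W s)%R w)) @^-1` E))%E.
Proof.
move=> s0 st mA mE; have t0 := le_trans s0 (ltW st).
rewrite setIC (bmr_indep hB) 1?muleC//; last by exists A => //; rewrite setTI.
have := measurable_fun_pair (measurable_driver s0)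
  (measurable_funB (measurable_driver t0) (measurable_driver s0)).
by move=> /(_ measurableT E mE); rewrite setTI.
Qed.

Lemma driver_increment_indep (s t : R) (A C : set R) :
  0 <= s -> s < t -> measurable A -> measurable C ->
  P (W s @^-1` A `&` (W t \- W s) @^-1` C) =
  (P (W s @^-1` A) * P ((W t \- W s)%R @^-1` C))%E.
Proof.
move=> s0 st mA mC.
pose tau n := if n is n'.+1 then if n' is _.+1 then t else s else 0%R : R.
have ndtau : nondecreasing_seq tau.
  apply/nondecreasing_seqP => -[|[|n]] //=; exact: ltW.
pose D (i : 'I_2) := if i == ord0 then A else C.
have mD i : measurable (D i) by rewrite /D; case: ifP.
have := bm_indep (bmr_W hB) (n := 2) (lexx 0 : 0 <= tau 0%N) ndtau mD.
rewrite !big_ord_recl big_ord0 mule1 /D/= => e.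
have W0 : (fun w => W s w - W 0 w) = W s.
  by apply/funext => w; rewrite brownian_driver0 subr0.
rewrite W0 in e; rewrite -e; congr (P _).
apply/seteqP; split => [w [ws wc] i _|w h].
  case: i => -[|[|//]] i /=; first by rewrite brownian_driver0 subr0.
  exact: wc.
split; last exact: (h (lift ord0 ord0)).
by have /= := h ord0 I; rewrite brownian_driver0 subr0.
Qed.

(** Fixing the value b of B 0 turns the event into one on W s and on the
    increment of W, which are independent.  The probability of the increment
    then leaves the integral over b, and the case of the whole line identifies
    the remaining integral as P (B s \in A). *)
Lemma brownian_increment_indep (s t : R) (A C : set R) :
  0 <= s -> s < t -> measurable A -> measurable C ->
  P (B s @^-1` A `&` (W t \- W s) @^-1` C) =
  (P (B s @^-1` A) * P ((W t \- W s)%R @^-1` C))%E.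
Proof.
move=> s0 st mA mC.
pose Z w := (W s w, (W t \- W s) w).
have mZ : measurable_fun setT Z by exact: measurable_fun_pair.
pose Zm := isMeasurableFun.Build _ _ _ _ Z mZ.
pose Z' : {mfun Omega >-> (R * R)%type} := HB.pack Z Zm.
have key D : measurable D -> P (B s @^-1` A `&` (W t \- W s) @^-1` D) =
  (\int[distribution P (B 0)]_b
    (P (W s @^-1` ((fun x => (b + x)%R) @^-1` A)) *
     P ((W t \- W s)%R @^-1` D)))%E.
  move=> mD.
  pose E := (fun z : R * (R * R) => z.1 + z.2.1) @^-1` A `&`
            (fun z => z.2.2) @^-1` D.
  have mE : measurable E.
    apply: measurableI; rewrite -[X in measurable X]setTI.
      apply: measurable_funD => //.
      exact: measurableT_comp.
    exact: (@measurableT_comp _ _ _ _ _ _ snd).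
  have -> : B s @^-1` A `&` (W t \- W s) @^-1` D =
      (fun w => (B 0 w, Z' w)) @^-1` E.
    apply/seteqP; split => w [/= h1 h2]; split => //=.
      by rewrite -(bmr_sum hB).
    by rewrite (bmr_sum hB).
  (* fix the value b of B 0 *)
  rewrite independent_pair_fubini1//; last first.
    by move=> A' E' mA' mE'; exact: start_indep_driver_pair.
  apply: eq_integral => b _.
  have mbA : measurable ((fun x => b + x) @^-1` A).
    rewrite -[X in measurable X]setTI.
    by apply: measurable_funD => //.
  rewrite -driver_increment_indep//; congr (P _).
  by apply/seteqP; split => w; rewrite /= /xsection /= ?inE.
rewrite key// ge0_integralZr//; last first.
  pose E := (fun z : R * R => z.1 + z.2) @^-1` A.
  have mE : measurable E.
    by rewrite -[X in measurable X]setTI; exact: measurable_funD.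
  rewrite (_ : (fun b => _) = distribution P (W s) \o xsection E).
    exact: measurable_fun_xsection.
  apply/funext => b /=; congr (P _).
  by apply/seteqP; split => w; rewrite /= /xsection /= ?inE.
have := key _ (@measurableT _ R).
rewrite preimage_setT setIT probability_setT => ->.
by under [in RHS]eq_integral do rewrite mule1.
Qed.

Lemma brownian_increment_law (s t : R) (A : set R) : 0 <= s -> s < t ->
  measurable A ->
  distribution P (W t \- W s) A = normal_prob 0 (Num.sqrt (t - s)) A.
Proof. by move=> s0 st mA; rewrite -(bm_increment (bmr_W hB) s0 st mA). Qed.

(** Every estimate on the pair (B s, B t) is obtained by fixing the increment v
    and evaluating the section of the event under the law of B s. *)
Lemma brownian_fubini (s t : R) (E : set (R * R)) :
  0 <= s -> s < t -> measurable E ->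
  P [set w | E (B s w, B t w - B s w)] =
  (\int[distribution P (W t \- W s)%R]_v P (B s @^-1` ysection E v))%E.
Proof.
move=> s0 st mE; have t0 := le_trans s0 (ltW st).
transitivity (P ((fun w => (B s w, (W t \- W s) w)) @^-1` E)).
  congr (P _); apply/seteqP.
  by split => w /=; rewrite (bmr_sum hB _ t0) (bmr_sum hB _ s0)
    opprD addrACA subrr add0r.
rewrite independent_pair_fubini2// => A C mA mC.
exact: brownian_increment_indep.
Qed.

Lemma brownian_increment_abs_moment (s t : R) : 0 <= s -> s < t ->
  (\int[distribution P (W t \- W s)%R]_v `|v|%:E <=
   (2 * Num.sqrt (t - s))%:E)%E.
Proof.
move=> s0 st; have ts : 0 < Num.sqrt (t - s) by rewrite sqrtr_gt0 subr_gt0.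
apply: le_trans (normal_abs_moment_le ts).
(* The two laws live on the real line with its Borel sets, presented as two
   different measurable types; the identity map carries one to the other. *)
have mid : measurable_fun setT
  (idfun : g_sigma_algebraType R.-ocitv.-measurable -> R).
  by move=> _ A mA; rewrite setTI.
pose Im := isMeasurableFun.Build _ _ _ _ _ mid.
pose I : {mfun (g_sigma_algebraType R.-ocitv.-measurable) >-> R} :=
  HB.pack (idfun : g_sigma_algebraType R.-ocitv.-measurable -> R) Im.
rewrite (eq_measure_integral
  (distribution (normal_prob 0 (Num.sqrt (t - s))) I)); last first.
  by move=> A mA _; exact: brownian_increment_law.
rewrite ge0_integral_pushforward//.
by apply/measurable_EFinP; exact: normr_measurable.
Qed.

Lemma brownian_increment_itv_ge (s t a b c : R) : 0 <= s -> s < t -> a <= b ->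
  (forall v, a <= v <= b -> `|v| <= c) ->
  (((b - a) * (normal_peak (Num.sqrt (t - s)) *
      expR (- c ^+ 2 / ((t - s) *+ 2))))%:E <=
   distribution P (W t \- W s)%R `[a, b])%E.
Proof.
move=> s0 st ab abc; rewrite (brownian_increment_law _ st)//.
rewrite -[X in expR (_ / (X *+ 2))]sqr_sqrtr; last by rewrite subr_ge0 ltW.
by apply: normal_prob_itv_ge; rewrite // sqrtr_gt0 subr_gt0.
Qed.

End brownian.

(** * Averages against a law with a small first moment *)

Section first_moment_averages.
Context {R : realType} (nu : probability R R).

Lemma bounded_integrable (k : R -> R) (a : R) : measurable_fun setT k ->
  (forall v, `|k v| <= a) -> nu.-integrable setT (EFin \o k).
Proof.
move=> mk ka; apply: measurable_bounded_integrable => //.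
  by rewrite (le_lt_trans (probability_le1 nu measurableT))// ltry.
exists a; split; first exact: num_real.
move=> b ab v _; exact: (le_trans (ka v) (ltW ab)).
Qed.

Variable kappa : R.
Hypothesis nu_moment : (\int[nu]_v `|v|%:E <= kappa%:E)%E.

Lemma integrable_normr : nu.-integrable setT (fun v => `|v|%:E).
Proof.
apply/integrableP; split.
  by apply/measurable_EFinP; exact: normr_measurable.
rewrite (eq_integral (fun v : R => `|v|%:E)); last first.
  by move=> v _ /=; rewrite normr_id.
by rewrite (le_lt_trans nu_moment) ?ltry.
Qed.

Lemma Rintegral_normr_le : \int[nu]_v `|v| <= kappa.
Proof.
rewrite -lee_fin /Rintegral fineK//.
exact: (integrable_fin_num _ integrable_normr).
Qed.

(** Averages are only ever compared through this bound: deviations of size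
    L |v| cost L times the first absolute moment. *)
Lemma Rintegral_le_affine (k : R -> R) (a c L : R) : measurable_fun setT k ->
  (forall v, `|k v| <= a) -> 0 <= L ->
  (forall v, k v <= c + L * `|v|) -> \int[nu]_v k v <= c + L * kappa.
Proof.
move=> mk ka L0 kc; have ik := bounded_integrable mk ka.
have ic : nu.-integrable setT (EFin \o cst c).
  exact/finite_measure_integrable_cst.
have iL : nu.-integrable setT (EFin \o (fun v => L * `|v|)).
  by have := integrableZl measurableT L integrable_normr.
apply: (@le_trans _ _ (\int[nu]_v (c + L * `|v|))).
  by apply: le_Rintegral => //; have := integrableD measurableT ic iL.
rewrite RintegralD// RintegralZl//; last exact: integrable_normr.
rewrite Rintegral_cst// (congr1 fine (probability_setT nu)) mulr1 lerD2l.
by rewrite ler_wpM2l// Rintegral_normr_le.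
Qed.

Lemma Rintegral_ge_affine (k : R -> R) (a c L : R) : measurable_fun setT k ->
  (forall v, `|k v| <= a) -> 0 <= L ->
  (forall v, c - L * `|v| <= k v) -> c - L * kappa <= \int[nu]_v k v.
Proof.
move=> mk ka L0 kc; have ik := bounded_integrable mk ka.
have : \int[nu]_v (-1 * k v) <= - c + L * kappa.
  apply: (@Rintegral_le_affine _ a) => // [|v|v].
  - exact: measurable_funM.
  - by rewrite mulN1r normrN.
  - by have := kc v; lra.
by rewrite RintegralZl//; lra.
Qed.

Lemma Rintegral_dist_le (k : R -> R) (a c L : R) : measurable_fun setT k ->
  (forall v, `|k v| <= a) -> 0 <= L ->
  (forall v, `|k v - c| <= L * `|v|) -> `|\int[nu]_v k v - c| <= L * kappa.
Proof.
move=> mk ka L0 kc; rewrite ler_distl; apply/andP; split.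
  apply: (Rintegral_ge_affine mk ka L0) => v.
  by have := kc v; rewrite ler_distl => /andP[].
apply: (Rintegral_le_affine mk ka L0) => v.
by have := kc v; rewrite ler_distl => /andP[].
Qed.

Lemma normr_Rintegral_le (k : R -> R) (a : R) : measurable_fun setT k ->
  (forall v, `|k v| <= a) -> `|\int[nu]_v k v| <= a.
Proof.
move=> mk ka; rewrite -[leRHS]addr0 -[X in _ <= _ + X](mul0r kappa).
have ka' v : - a <= k v <= a by have := ka v; rewrite ler_norml.
rewrite ler_norml opprD; apply/andP; split.
  by apply: (Rintegral_ge_affine mk ka (lexx 0)) => v; have := ka' v; lra.
by apply: (Rintegral_le_affine mk ka (lexx 0)) => v; have := ka' v; lra.
Qed.

Lemma Rintegral_ge_indic (k : R -> R) (a c : R) (A : set R) :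
  measurable_fun setT k -> (forall v, 0 <= k v <= a) -> measurable A ->
  (forall v, A v -> c <= k v) -> c * fine (nu A) <= \int[nu]_v k v.
Proof.
move=> mk ka mA kc; have ik : nu.-integrable setT (EFin \o k).
  apply: (@bounded_integrable _ a) => // v.
  by have /andP[k0 ?] := ka v; rewrite ger0_norm.
have iA : nu.-integrable setT (EFin \o \1_A).
  by apply: (@bounded_integrable _ 1) => // v; rewrite indicE; case: (v \in A);
    rewrite /= ?normr0 ?normr1.
have -> : fine (nu A) = \int[nu]_v \1_A v.
  by rewrite /Rintegral integral_indic// setIT.
rewrite -RintegralZl//; apply: le_Rintegral => //.
  by have := integrableZl measurableT c iA.
move=> v _; rewrite indicE; have [vA|_] := boolP (v \in A).
  by rewrite mulr1; apply: kc; rewrite inE in vA.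
by rewrite mulr0; have /andP[] := ka v.
Qed.

End first_moment_averages.

(** * Distribution functions and their derivatives *)

Section derivative_increments.
Context {R : realType}.
Implicit Types H h : R -> R.

Lemma derivable_mvt H h (a b : R) : (forall x : R, is_derive x 1 H (h x)) ->
  a <= b -> exists2 c, a <= c <= b & H b - H a = h c * (b - a).
Proof.
move=> dH ab.
have [c cab ->] : exists2 c, c \in `[a, b] & H b - H a = h c * (b - a).
  apply: MVT_segment => //; apply: derivable_within_continuous => x _.
  exact: (@ex_derive _ _ _ _ _ _ _ (dH x)).
by exists c => //; rewrite in_itv in cab.
Qed.

(** Recovers a pointwise bound on a density from the masses of short intervals;
    increments to the right are enough. *)
Lemma derive_ge_increment H (x a c del : R) : is_derive x 1 H a -> 0 < del ->
  (forall e, 0 < e < del -> c * e <= H (x + e) - H x) -> c <= a.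
Proof.
move=> /is_derive1_caratheodory[g [Hg gx <-]] del0 Hc.
apply: (@cvgr_to_ge _ (x^'+) _ _ g).
  by apply: cvg_at_right_filter.
near=> z.
have xz : 0 < z - x by rewrite subr_gt0; near: z; exact: nbhs_right_gt.
have := Hc (z - x); rewrite subrKC Hg ler_pM2r//; apply.
rewrite xz/= ltrBlDl; near: z; apply: nbhs_right_lt; by rewrite ltrDl.
Unshelve. all: by end_near. Qed.

Lemma normr_derive_le H (x a c : R) : is_derive x 1 H a ->
  (forall e, 0 < e -> `|H (x + e) - H x| <= c * e) -> `|a| <= c.
Proof.
move=> dH Hc; rewrite ler_norml; apply/andP; split.
  apply: (derive_ge_increment dH ltr01) => e /andP[e0 _].
  by have := Hc e e0; rewrite ler_norml mulNr => /andP[].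
have dHN : is_derive x 1 (- H) (- a) by exact: is_deriveN.
rewrite -lerN2; apply: (derive_ge_increment dHN ltr01) => e /andP[e0 _].
by have := Hc e e0; rewrite ler_norml => /andP[_]; rewrite !fctE; lra.
Qed.

End derivative_increments.

Section real_cdf.
Context d (Omega : measurableType d) (R : realType) (P : probability Omega R).
Implicit Types X : {RV P >-> R}.

Definition rcdf X (x : R) : R := fine (cdf X x).

Lemma rcdfE X x : cdf X x = (rcdf X x)%:E.
Proof. by rewrite /rcdf fineK// fin_num_measure. Qed.

Lemma rcdf_ge0 X x : 0 <= rcdf X x.
Proof. by rewrite fine_ge0. Qed.

Lemma rcdf_le1 X x : rcdf X x <= 1.
Proof. by rewrite -lee_fin -rcdfE cdf_le1. Qed.

Lemma rcdf_nondecreasing X : nondecreasing_fun (rcdf X).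
Proof. by move=> x y xy; rewrite -lee_fin -!rcdfE cdf_nondecreasing. Qed.

Lemma measurable_rcdf_shift X x :
  measurable_fun setT (fun v : R => rcdf X (x - v)).
Proof.
apply: (@measurableT_comp _ _ _ _ _ _ (rcdf X)).
  by apply: nondecreasing_measurable => //; exact: rcdf_nondecreasing.
exact: measurable_funB.
Qed.

Lemma measurable_itv_oc_event X (x y : R) :
  measurable [set w | y < X w <= x].
Proof.
have -> : [set w | y < X w <= x] = X @^-1` `]y, x].
  by apply/seteqP; split => w /=; rewrite in_itv.
exact: measurable_funPTI.
Qed.

(** The maximum with 0 covers the empty interval, so that the crossing
    probabilities below need no case distinction. *)
Lemma prob_itv_oc X (x y : R) :
  fine (P [set w | y < X w <= x]) = Num.max 0 (rcdf X x - rcdf X y).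
Proof.
have [yx|xy] := ltP y x; last first.
  have -> : [set w | y < X w <= x] = set0.
    apply/seteqP; split => w //= /andP[/lt_le_trans/[apply]].
    by rewrite ltNge xy.
  by rewrite measure0 max_l// subr_le0 rcdf_nondecreasing.
rewrite max_r ?subr_ge0 ?rcdf_nondecreasing// ?ltW//.
have -> : rcdf X x = rcdf X y + fine (P [set w | y < X w <= x]).
  have mE := measurable_itv_oc_event X x y.
  rewrite /rcdf -fineD ?fin_num_measure//; congr fine.
  rewrite /cdf /distribution /pushforward -measureU//.
  - congr (P _); apply/seteqP; split => w /=; rewrite !in_itv/=.
      by move=> wx; case: (leP (X w) y) => h; [left|right].
    by case=> [|/andP[]//]; move=> /le_trans; apply; exact: ltW.
  - exact: measurable_funPTI.
  - apply/seteqP; split => w //=; rewrite in_itv/= => -[wy /andP[]].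
    by rewrite ltNge wy.
by rewrite addrAC subrr add0r.
Qed.

Lemma rcdf_tailN X (e : R) : 0 < e -> exists a, rcdf X a < e.
Proof.
move=> e0; have /fine_cvg X0 := cvg_cdfNy0 X.
have /filter_ex[a ha] : \forall a \near -oo, rcdf X a < e.
  exact: (cvgr_lt _ X0).
by exists a.
Qed.

Lemma rcdf_tail X (e : R) : 0 < e -> exists a, 1 - e < rcdf X a.
Proof.
move=> e0; have /fine_cvg X1 := cvg_cdfy1 X.
have e1 : 1 - e < 1 by rewrite ltrBlDr ltrDl.
have /filter_ex[a ha] : \forall a \near +oo, 1 - e < rcdf X a.
  exact: (cvgr_gt _ X1).
by exists a.
Qed.

(** The fundamental theorem of calculus: a continuous density can be read off
    the distribution function at every point. *)
Lemma is_derive_rcdf X (g : R -> R) (x : R) : has_density X g -> continuous g ->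
  is_derive x 1 (rcdf X) (g x).
Proof.
move=> [mg g0 gE] cg.
have ig : (@lebesgue_measure R).-integrable `]-oo, (x + 1)%R] (EFin \o g).
  apply/integrableP; split.
    by apply/measurable_EFinP; exact: measurable_funTS.
  under eq_integral do rewrite /= ger0_norm//.
  rewrite -gE// (le_lt_trans (probability_le1 _ _)) ?ltry//.
have xu : x < x + 1 by rewrite ltrDl.
have [] := @continuous_FTC1 R g -oo%O x (x + 1) xu ig (ltNyr _) (@cg x).
move=> dF F'.
have -> : rcdf X = (fun y => \int[lebesgue_measure]_(t in `]-oo, y]) g t).
  by apply/funext => y; rewrite /rcdf /cdf gE.
by apply: DeriveDef => //; rewrite -derive1E.
Qed.

End real_cdf.

(** * Evolution of the distribution function *)

Section evolution.
Context d (Omega : measurableType d) (R : realType) (P : probability Omega R).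
Variables B W : R -> {RV P >-> R}.
Hypothesis hB : brownian_motion_random_start B W.

Local Notation G t := (rcdf (B t)).
Local Notation nu s t := (distribution P (W t \- W s)%R).

(** B t is the sum of B s and of an independent increment v. *)
Lemma rcdf_evolution (s t x : R) : 0 <= s -> s < t ->
  G t x = \int[nu s t]_v G s (x - v).
Proof.
move=> s0 st; pose E := (fun z : R * R => z.1 + z.2) @^-1` `]-oo, x].
have mE : measurable E.
  by rewrite -[X in measurable X]setTI; exact: measurable_funD.
rewrite /Rintegral {1}/rcdf; congr fine.
have -> : cdf (B t) x = P [set w | E (B s w, B t w - B s w)].
  by congr (P _); apply/seteqP; split => w; rewrite /E /= subrKC.
rewrite (brownian_fubini hB)//; apply: eq_integral => v _.
rewrite -rcdfE; congr (P _).
by apply/seteqP; split => w; rewrite /ysection/= inE /= !in_itv/= lerBrDr.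
Qed.

(** Given the increment v, the event confines B s to the interval ]y - v, x]. *)
Lemma joint_tail_evolution (s t x y : R) : 0 <= s -> s < t ->
  fine (P [set w | B s w <= x /\ y < B t w]) =
  \int[nu s t]_v Num.max 0 (G s x - G s (y - v)).
Proof.
move=> s0 st.
pose E := (fun z : R * R => z.1) @^-1` `]-oo, x] `&`
          (fun z : R * R => z.1 + z.2) @^-1` `]y, +oo[.
have mE : measurable E.
  apply: measurableI; rewrite -[X in measurable X]setTI.
    exact: measurable_fst.
  exact: measurable_funD.
rewrite /Rintegral; congr fine.
have -> : [set w | B s w <= x /\ y < B t w] =
    [set w | E (B s w, B t w - B s w)].
  by apply/seteqP; split => w; rewrite /E /= !in_itv/= subrKC andbT.
rewrite (brownian_fubini hB)//; apply: eq_integral => v _.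
rewrite -prob_itv_oc fineK ?fin_num_measure//; last first.
  exact: measurable_itv_oc_event.
congr (P _).
apply/seteqP; split => w;
  rewrite /ysection/= inE /E /= !in_itv/= andbT -ltrBlDr.
  by case=> -> ->.
by move=> /andP[-> ->].
Qed.

End evolution.

(** * Regularity of the density in space and time *)

Section density_regularity.
Context d (Omega : measurableType d) (R : realType) (P : probability Omega R).
Variables B W : R -> {RV P >-> R}.
Hypothesis hB : brownian_motion_random_start B W.
Variable u : R -> R -> R.
Hypothesis hu : forall t : R, 0 <= t -> has_density (B t) (fun x => u x t).
Hypothesis cu : forall t : R, 0 <= t -> continuous (fun x => u x t).
Variables M L : R.
Hypothesis u0_le : forall x, u x 0 <= M.
Hypothesis L_ge0 : 0 <= L.
Hypothesis u0_lip : forall x y, `|u x 0 - u y 0| <= L * `|x - y|.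

Local Notation G t := (rcdf (B t)).
Local Notation nu s t := (distribution P (W t \- W s)%R).
Local Notation incr t e x := (G t (x + e) - G t x).

Lemma density_ge0 (t x : R) : 0 <= t -> 0 <= u x t.
Proof. by move=> /hu[_ + _]; exact. Qed.

Lemma density_bound_ge0 : 0 <= M.
Proof. exact: le_trans (density_ge0 0 (lexx 0)) (u0_le 0). Qed.

Lemma is_derive_cdf_shift (t x z : R) : 0 <= t ->
  is_derive z 1 (fun z => G t (x + z)) (u (x + z) t).
Proof.
move=> t0.
have -> : (fun z => G t (x + z)) = G t \o shift x.
  by apply/funext => y; rewrite /= addrC.
apply: is_derive_eq.
  exact: is_derive1_comp (is_derive_rcdf _ (hu t0) (cu t0))
    (is_derive_shift _ _ _).
by rewrite mulr1 addrC.
Qed.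

Lemma cdf_incrB_evolution (s t x y : R) : 0 <= s -> s < t ->
  G t x - G t y = \int[nu s t]_v (G s (x - v) - G s (y - v)).
Proof.
move=> s0 st; rewrite !(rcdf_evolution hB _ s0 st) RintegralB//;
  apply: (@bounded_integrable _ _ _ 1); try exact: measurable_rcdf_shift;
  by move=> v; rewrite ger0_norm ?rcdf_ge0 ?rcdf_le1.
Qed.

Lemma measurable_cdf_shiftB (s x y : R) :
  measurable_fun setT (fun v : R => G s (x - v) - G s (y - v)).
Proof. by apply: measurable_funB; exact: measurable_rcdf_shift. Qed.

Lemma cdf_mvt (t x y : R) : 0 <= t -> x <= y ->
  exists2 c, x <= c <= y & G t y - G t x = u c t * (y - x).
Proof.
move=> t0 xy; apply: (derivable_mvt _ xy) => z.
exact: is_derive_rcdf (hu t0) (cu t0).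
Qed.

(** At time 0 an interval of length e has mass at most M e wherever it lies, so
    averaging over its translates keeps the bound; then divide by e. *)
Lemma density_le (t x : R) : 0 <= t -> u x t <= M.
Proof.
rewrite le_eqVlt => /predU1P[<-//|t0].
rewrite (le_trans (ler_norm _))//.
apply: (normr_derive_le (is_derive_rcdf x (hu (ltW t0)) (cu (ltW t0)))) => e e0.
rewrite (cdf_incrB_evolution _ _ (lexx 0) t0).
apply: normr_Rintegral_le => [||v].
- exact: (brownian_increment_abs_moment hB (lexx 0) t0).
- exact: measurable_cdf_shiftB.
have [|c _] := @cdf_mvt 0 (x - v) (x + e - v) (lexx 0).
  by rewrite lerB// lerDl ltW.
move=> ->; rewrite (_ : x + e - v - (x - v) = e); last by ring.
rewrite ger0_norm ?mulr_ge0 ?density_ge0 ?(ltW e0)//.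
by rewrite ler_wpM2r// ltW.
Qed.

Lemma cdf_lip (t x y : R) : 0 <= t -> `|G t x - G t y| <= M * `|x - y|.
Proof.
move=> t0; wlog yx : x y / y <= x.
  by move=> H; have [/H//|/ltW/H] := leP y x; rewrite distrC [X in _ * X]distrC.
have [c _ ->] := cdf_mvt t0 yx.
by rewrite normrM ler_wpM2r// ger0_norm ?density_ge0 ?density_le.
Qed.

(** Translating by v changes the distribution function by at most M |v|. *)
Lemma cdf_time_dist (s t x : R) : 0 <= s -> s < t ->
  `|G t x - G s x| <= M * (2 * Num.sqrt (t - s)).
Proof.
move=> s0 st; rewrite (rcdf_evolution hB _ s0 st).
apply: (@Rintegral_dist_le _ _ _ _ _ 1) => [||v||v].
- exact: (brownian_increment_abs_moment hB s0 st).
- exact: measurable_rcdf_shift.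
- by rewrite ger0_norm ?rcdf_ge0 ?rcdf_le1.
- exact: density_bound_ge0.
- rewrite (le_trans (cdf_lip _ _ s0))// (_ : x - v - x = - v) ?normrN//.
  by rewrite addrAC subrr add0r.
Qed.

Lemma is_derive_cdf_diff (s t x y : R) : 0 <= s -> 0 <= t ->
  forall z : R, is_derive z 1 (fun z => G s (x + z) - G t (y + z))
    (u (x + z) s - u (y + z) t).
Proof.
move=> s0 t0 z; apply: is_deriveB; exact: is_derive_cdf_shift.
Qed.

(** The mean value theorem for e |-> G (x + e) - G (y + e), whose derivative is
    a difference of densities at distance |x - y|. *)
Lemma incrB_le (t x y e : R) : 0 <= t -> 0 <= e ->
  (forall x y, `|u x t - u y t| <= L * `|x - y|) ->
  `|incr t e x - incr t e y| <= L * `|x - y| * e.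
Proof.
move=> t0 e0 ut.
have [c _] := derivable_mvt (is_derive_cdf_diff x y t0 t0) e0.
rewrite !addr0 subr0 => h.
have -> : incr t e x - incr t e y = G t (x + e) - G t (y + e) - (G t x - G t y).
  by ring.
rewrite h normrM (ger0_norm e0) ler_wpM2r//.
by rewrite (le_trans (ut _ _))// opprD addrACA subrr addr0.
Qed.

(** Densities at different times and places are compared through the masses of
    intervals of the same length e. *)
Lemma normr_densityB_le (s t x y c : R) : 0 <= s -> 0 <= t ->
  (forall e, 0 < e -> `|incr s e x - incr t e y| <= c * e) ->
  `|u x s - u y t| <= c.
Proof.
move=> s0 t0 H; have := is_derive_cdf_diff x y s0 t0 0.
rewrite !addr0 => /normr_derive_le; apply => e e0.
rewrite add0r !addr0 (_ : _ - _ = incr s e x - incr t e y); first exact: H.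
by ring.
Qed.

Lemma integrable_cdf_shiftB (Q : probability R R) (s x y : R) :
  Q.-integrable setT (EFin \o (fun v => G s (x - v) - G s (y - v))).
Proof.
apply: (@bounded_integrable _ _ _ 1) => [|v].
  exact: measurable_cdf_shiftB.
have := rcdf_ge0 (B s) (x - v); have := rcdf_le1 (B s) (x - v).
have := rcdf_ge0 (B s) (y - v); have := rcdf_le1 (B s) (y - v).
by rewrite ler_norml => *; lra.
Qed.

(** The bound on the difference of the masses of two translated intervals holds
    at time 0 and survives averaging over common translations. *)
Lemma density_lip (t x y : R) : 0 <= t -> `|u x t - u y t| <= L * `|x - y|.
Proof.
rewrite le_eqVlt => /predU1P[<-//|t0].
apply: normr_densityB_le; rewrite ?(ltW t0)// => e e0.
rewrite !(cdf_incrB_evolution _ _ (lexx 0) t0) -RintegralB//;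
  try exact: integrable_cdf_shiftB.
apply: normr_Rintegral_le => [||v].
- exact: (brownian_increment_abs_moment hB (lexx 0) t0).
- by apply: measurable_funB; exact: measurable_cdf_shiftB.
rewrite ![_ + e - v]addrAC.
rewrite (le_trans (incrB_le _ _ (lexx 0) (ltW e0) u0_lip))//.
by rewrite opprB addrA subrK.
Qed.

(** Translating an interval of length e by v changes its mass by at most
    L |v| e. *)
Lemma density_time_dist (s t x : R) : 0 <= s -> s < t ->
  `|u x t - u x s| <= L * (2 * Num.sqrt (t - s)).
Proof.
move=> s0 st; have t0 := le_trans s0 (ltW st).
apply: normr_densityB_le => // e e0.
rewrite (cdf_incrB_evolution _ _ s0 st) mulrAC.
apply: (@Rintegral_dist_le _ _ _ _ _ 1) => [||v||v].
- exact: (brownian_increment_abs_moment hB s0 st).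
- exact: measurable_cdf_shiftB.
- have := rcdf_ge0 (B s) (x + e - v); have := rcdf_le1 (B s) (x + e - v).
  have := rcdf_ge0 (B s) (x - v); have := rcdf_le1 (B s) (x - v).
  by rewrite ler_norml => *; lra.
- by rewrite mulr_ge0// ltW.
- rewrite ![_ + e - v]addrAC mulrAC.
  rewrite (le_trans (incrB_le _ _ s0 (ltW e0) _))//.
    by move=> *; exact: density_lip.
  by rewrite addrAC subrr add0r normrN.
Qed.

Lemma density_time_dist_le (s t x : R) : 0 <= s -> s <= t ->
  `|u x t - u x s| <= L * (2 * Num.sqrt (t - s)).
Proof.
move=> s0; rewrite le_eqVlt => /predU1P[<-|]; last exact: density_time_dist.
by rewrite !subrr normr0 sqrtr0 !mulr0.
Qed.

Lemma cdf_time_dist_le (s t x : R) : 0 <= s -> s <= t ->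
  `|G t x - G s x| <= M * (2 * Num.sqrt (t - s)).
Proof.
move=> s0; rewrite le_eqVlt => /predU1P[<-|]; last exact: cdf_time_dist.
by rewrite !subrr normr0 sqrtr0 !mulr0.
Qed.

(** By the mean value theorem the distribution function grows with slope at
    least m on the segment from z towards y, cut off at distance r. *)
Lemma cdf_separation (t z m r y : R) : 0 <= t -> 0 <= m -> 0 <= r ->
  (forall x, `|x - z| <= r -> m <= u x t) ->
  m * Num.min `|y - z| r <= `|G t y - G t z|.
Proof.
move=> t0 m0 r0 um.
have [zy|yz] := leP z y.
  rewrite (ger0_norm (_ : 0 <= y - z)) ?subr_ge0//.
  rewrite ger0_norm ?subr_ge0 ?rcdf_nondecreasing//.
  set e := Num.min _ _.
  have e0 : 0 <= e by rewrite le_min subr_ge0 zy.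
  have [|c /andP[zc ce] Ge] := @cdf_mvt t z (z + e) t0; first by rewrite lerDl.
  apply: (@le_trans _ _ (G t (z + e) - G t z)).
    rewrite Ge addrAC subrr add0r ler_wpM2r// um// ger0_norm ?subr_ge0//.
    by rewrite lerBlDl (le_trans ce)// lerD2l ge_min lexx orbT.
  by rewrite lerD2r rcdf_nondecreasing// -lerBrDl ge_min lexx.
rewrite (ltr0_norm (_ : y - z < 0)) ?subr_lt0// opprB.
rewrite distrC ger0_norm ?subr_ge0 ?rcdf_nondecreasing ?(ltW yz)//.
set e := Num.min _ _.
have e0 : 0 <= e by rewrite le_min subr_ge0 ltW.
have [|c /andP[zc ce] Ge] := @cdf_mvt t (z - e) z t0; first by rewrite gerBl.
apply: (@le_trans _ _ (G t z - G t (z - e))).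
  rewrite Ge opprB subrKC ler_wpM2r// um// ler0_norm ?subr_le0// opprB.
  by rewrite lerBlDr -lerBlDl (le_trans _ zc)// lerB// ge_min lexx orbT.
by rewrite lerB// rcdf_nondecreasing// lerBrDr -lerBrDl ge_min lexx.
Qed.

End density_regularity.

(** * Tightness, and the quantile curve *)

Section tightness.
Context d (Omega : measurableType d) (R : realType) (P : probability Omega R).

Variables B W : R -> {RV P >-> R}.
Hypothesis hB : brownian_motion_random_start B W.

Local Notation G t := (rcdf (B t)).
Local Notation nu s t := (distribution P (W t \- W s)%R).

(** Markov's inequality in affine form: the translate of the distribution
    function of B 0 by v is at most b / 2, except when v < - K, and then
    |v| / K exceeds 1. *)
Lemma cdf_tightN (T b : R) : 0 <= T -> 0 < b ->
  exists a, forall t, 0 <= t <= T -> G t a < b.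
Proof.
move=> T0 b0; have b20 : 0 < b / 2 by rewrite divr_gt0.
have [a Ga] := rcdf_tailN (B 0) b20.
(* with this K the Markov term 2 sqrt t / K is less than b / 2 up to time T *)
pose K := (4 * Num.sqrt T + 1) / b.
have K0 : 0 < K by rewrite divr_gt0// ltr_wpDl// mulr_ge0.
exists (a - K) => t /andP[+ tT]; rewrite le_eqVlt => /predU1P[<-|t0].
  have : G 0 (a - K) <= G 0 a by apply: rcdf_nondecreasing; rewrite gerBl ltW.
  lra.
rewrite (rcdf_evolution hB _ (lexx 0) t0).
apply: (@le_lt_trans _ _ (b / 2 + K^-1 * (2 * Num.sqrt (t - 0)))).
  apply: (@Rintegral_le_affine _ _ _ _ _ 1) => [||v||v].
  - exact: (brownian_increment_abs_moment hB (lexx 0) t0).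
  - exact: measurable_rcdf_shift.
  - by rewrite ger0_norm ?rcdf_ge0 ?rcdf_le1.
  - by rewrite invr_ge0 ltW.
  - have [Kv|vK] := leP (- K) v.
      apply: (@le_trans _ _ (b / 2)).
        apply: le_trans (ltW Ga); apply: rcdf_nondecreasing.
        by rewrite lerBlDr lerBlDl; lra.
      by rewrite lerDl mulr_ge0// invr_ge0 ltW.
    apply: (le_trans (rcdf_le1 _ _)).
    apply: (@le_trans _ _ (K^-1 * `|v|)); last by rewrite lerDr ltW.
    rewrite -ler_pdivrMl ?invr_gt0// invrK mulr1 ltr0_norm; lra.
rewrite subr0 -ltrBrDl (_ : b - b / 2 = b / 2); last by lra.
rewrite mulrC ltr_pdivrMr//.
have -> : b / 2 * K = (4 * Num.sqrt T + 1) / 2.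
  by rewrite /K; field; rewrite gt_eqF.
have : Num.sqrt t <= Num.sqrt T by rewrite ler_wsqrtr.
have := sqrtr_ge0 t; lra.
Qed.

(** The mirror image of [cdf_tightN], for the upper tail. *)
Lemma cdf_tight (T b : R) : 0 <= T -> 0 < b ->
  exists a, forall t, 0 <= t <= T -> 1 - b < G t a.
Proof.
move=> T0 b0; have b20 : 0 < b / 2 by rewrite divr_gt0.
have [a Ga] := rcdf_tail (B 0) b20.
pose K := (4 * Num.sqrt T + 1) / b.
have K0 : 0 < K by rewrite divr_gt0// ltr_wpDl// mulr_ge0.
exists (a + K) => t /andP[+ tT]; rewrite le_eqVlt => /predU1P[<-|t0].
  have : G 0 a <= G 0 (a + K) by apply: rcdf_nondecreasing; rewrite lerDl ltW.
  lra.
rewrite (rcdf_evolution hB _ (lexx 0) t0).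
apply: (@lt_le_trans _ _ (1 - b / 2 - K^-1 * (2 * Num.sqrt (t - 0))));
  last first.
  apply: (@Rintegral_ge_affine _ _ _ _ _ 1) => [||v||v].
  - exact: (brownian_increment_abs_moment hB (lexx 0) t0).
  - exact: measurable_rcdf_shift.
  - by rewrite ger0_norm ?rcdf_ge0 ?rcdf_le1.
  - by rewrite invr_ge0 ltW.
  - have Kv0 : 0 <= K^-1 * `|v| by rewrite mulr_ge0// invr_ge0 ltW.
    have [vK|Kv] := leP v K.
      apply: (@le_trans _ _ (1 - b / 2)); first by lra.
      apply: le_trans (ltW Ga) _; apply: rcdf_nondecreasing; lra.
    apply: le_trans (rcdf_ge0 _ _).
    have : 1 <= K^-1 * `|v|; last by lra.
    by rewrite -ler_pdivrMl ?invr_gt0// invrK mulr1 gtr0_norm; lra.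
suff : K^-1 * (2 * Num.sqrt (t - 0)) < b / 2 by lra.
rewrite subr0 mulrC ltr_pdivrMr//.
have -> : b / 2 * K = (4 * Num.sqrt T + 1) / 2.
  by rewrite /K; field; rewrite gt_eqF.
have : Num.sqrt t <= Num.sqrt T by rewrite ler_wsqrtr.
have := sqrtr_ge0 t; lra.
Qed.

End tightness.

Section quantile_curve.
Context d (Omega : measurableType d) (R : realType) (P : probability Omega R).
Variables B W : R -> {RV P >-> R}.
Hypothesis hB : brownian_motion_random_start B W.
Variable u : R -> R -> R.
Hypothesis hu : forall t : R, 0 <= t -> has_density (B t) (fun x => u x t).
Hypothesis cu : forall t : R, 0 <= t -> continuous (fun x => u x t).
Variables M L : R.
Hypothesis u0_le : forall x, u x 0 <= M.
Hypothesis L_ge0 : 0 <= L.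
Hypothesis u0_lip : forall x y, `|u x 0 - u y 0| <= L * `|x - y|.
Variables (alpha T : R) (q : R -> R).
Hypotheses (alpha_gt0 : 0 < alpha) (alpha_lt1 : alpha < 1) (T_gt0 : 0 < T).
Hypothesis hq : forall t : R, 0 <= t -> rcdf (B t) (q t) = alpha.
Hypothesis uq0_gt0 : 0 < u (q 0) 0.

Local Notation G t := (rcdf (B t)).
Local Notation nu s t := (distribution P (W t \- W s)%R).

Lemma quantile_bounded :
  exists2 Q : R, 0 <= Q & forall t : R, 0 <= t <= T -> `|q t| <= Q.
Proof.
have [a Ga] := cdf_tightN hB (ltW T_gt0) alpha_gt0.
have [b Gb] : exists b, forall t, 0 <= t <= T -> 1 - (1 - alpha) < G t b.
  by apply: (cdf_tight hB (ltW T_gt0)); rewrite subr_gt0.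
exists (`|a| + `|b|); first exact: addr_ge0.
move=> t tT; have /andP[t0 _] := tT; have := Ga _ tT; have := Gb _ tT.
rewrite subKr -(hq t0) => h1 h2.
have aq : a < q t.
  rewrite ltNge; apply: contraPN h2 => /(rcdf_nondecreasing (B t)).
  by rewrite leNgt => /negP.
have qb : q t < b.
  rewrite ltNge; apply: contraPN h1 => /(rcdf_nondecreasing (B t)).
  by rewrite leNgt => /negP.
rewrite ler_norml; apply/andP; split.
  have := ler_norm (- a); rewrite normrN; have := normr_ge0 b; lra.
by have := ler_norm b; have := normr_ge0 a; lra.
Qed.

(** Within this distance of a point where an L-Lipschitz function is at least
    m, it is at least m / 2; adding 1 to L keeps the radius meaningful when
    L = 0. *)
Definition half_radius (m : R) : R := m / (2 * (L + 1)).

Lemma half_radius_gt0 m : 0 < m -> 0 < half_radius m.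
Proof. by move=> m0; rewrite divr_gt0// mulr_gt0// ltr_wpDl. Qed.

Lemma density_ge_near (t z m x : R) : 0 <= t -> 0 < m -> m <= u z t ->
  `|x - z| <= half_radius m -> m / 2 <= u x t.
Proof.
move=> t0 m0 mu xz; have L1 : 0 < L + 1 by rewrite ltr_wpDl.
have := density_lip hB hu cu u0_lip x z t0.
have : L * `|x - z| <= m / 2.
  apply: (@le_trans _ _ ((L + 1) * half_radius m)).
    by apply: ler_pM => //; lra.
  by rewrite /half_radius le_eqVlt; apply/orP; left; apply/eqP; field;
    rewrite gt_eqF.
by rewrite ler_distl => ? /andP[]; lra.
Qed.

Lemma ler_normal_peak (s s' : R) : 0 < s -> s <= s' ->
  normal_peak s' <= normal_peak s.
Proof.
move=> s0 ss'; have s'0 := lt_le_trans s0 ss'.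
have pos x : 0 < x -> 0 < Num.sqrt (x ^+ 2 * pi *+ 2) :> R.
  by move=> x0; rewrite sqrtr_gt0 mulrn_wgt0// mulr_gt0 ?pi_gt0// exprn_gt0.
rewrite /normal_peak lef_pV2 ?posrE ?pos// ler_wsqrtr// lerMn2r/=.
by rewrite ler_wpM2r ?pi_ge0// lerXn2r// nnegrE ltW.
Qed.

(** The increments v leading to x from points between q 0 and q 0 + r / 2, where
    f is at least half of f (q 0), have a mass bounded below, uniformly for x
    bounded and t bounded and away from 0. *)
Lemma density_ge_late (t0 Q : R) : 0 < t0 -> 0 <= Q -> exists2 c : R, 0 < c &
  forall t x : R, t0 <= t <= T -> `|x| <= Q -> c <= u x t.
Proof.
move=> t00 Q0; set m := u (q 0) 0; pose r := half_radius m.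
have r0 : 0 < r by exact: half_radius_gt0.
pose C := Q + `|q 0| + r.
have C0 : 0 < C by rewrite ltr_wpDl// addr_ge0.
pose g := r / 2 * (normal_peak (Num.sqrt T) * expR (- C ^+ 2 / (t0 *+ 2))).
have g0 : 0 < g.
  apply: mulr_gt0; first by rewrite divr_gt0.
  apply: mulr_gt0; last exact: expR_gt0.
  by rewrite normal_peak_gt0// gt_eqF// sqrtr_gt0.
exists (m / 2 * g); first by rewrite mulr_gt0// divr_gt0.
move=> t x /andP[t0t tT] xQ; have tgt0 := lt_le_trans t00 t0t.
have dG := is_derive_rcdf x (hu (ltW tgt0)) (cu (ltW tgt0)).
apply: (derive_ge_increment dG (_ : 0 < r / 2)); first by rewrite divr_gt0.
move=> e /andP[e0 er].
rewrite (cdf_incrB_evolution hB _ _ (lexx 0) tgt0).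
(* for v in I and e < r / 2, the interval [x - v, x + e - v] is within r of
   q 0 *)
pose I := `[x - q 0 - r / 2, x - q 0]%classic : set R.
apply: (@le_trans _ _ (m / 2 * e * fine (nu 0 t I))); last first.
  apply: (@Rintegral_ge_indic _ _ _ 1) => [|v||v].
  - exact: measurable_cdf_shiftB.
  - rewrite subr_ge0 rcdf_nondecreasing/=; last by lra.
    have := rcdf_ge0 (B 0) (x - v); have := rcdf_le1 (B 0) (x + e - v); lra.
  - exact: measurable_itv.
  - rewrite /I/= in_itv/= => /andP[v1 v2].
    have [|c /andP[c1 c2] ->] :=
      @cdf_mvt _ _ _ _ _ _ hu cu 0 (x - v) (x + e - v) (lexx 0).
      by lra.
    have -> : x + e - v - (x - v) = e by ring.
    rewrite ler_wpM2r ?(ltW e0)//; apply: (@density_ge_near 0 (q 0)) => //.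
    by rewrite -/r ler_norml; lra.
rewrite mulrAC ler_wpM2l ?mulr_ge0 ?divr_ge0 ?(ltW e0) ?(ltW uq0_gt0)//.
have -> : g = (x - q 0 - (x - q 0 - r / 2)) *
    (normal_peak (Num.sqrt T) * expR (- C ^+ 2 / (t0 *+ 2))).
  by rewrite /g; congr (_ * _); ring.
rewrite -lee_fin fineK ?fin_num_measure//; last exact: measurable_itv.
apply: le_trans (brownian_increment_itv_ge (c := C) hB (lexx 0) tgt0 _ _)
  => [||v].
- rewrite lee_fin subr0 ler_wpM2l//; first by lra.
  apply: ler_pM => //; rewrite ?normal_peak_ge0 ?expR_ge0//.
    by rewrite ler_normal_peak ?sqrtr_gt0// ler_wsqrtr.
  rewrite ler_expR !mulNr lerN2 ler_wpM2l ?sqr_ge0//.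
  rewrite lef_pV2 ?posrE ?mulrn_wgt0//.
  by rewrite lerMn2r.
- by lra.
- move=> /andP[v1 v2]; rewrite ler_norml /C.
  move: xQ; rewrite ler_norml => /andP[x1 x2].
  have := ler_norm (q 0); have := ler_norm (- q 0); rewrite normrN; lra.
Qed.


(** Up to time tau^2 the distribution function has moved too little for the
    quantile to leave the r-neighbourhood of q 0, on which f is at least m / 2
    with m = f (q 0), and the density has lost at most m / 8; after that time
    [density_ge_late] applies to the bounded curve q. *)
Lemma quantile_density_pos : exists2 m : R, 0 < m &
  forall t : R, 0 <= t <= T -> m <= u (q t) t.
Proof.
have [Q Q0 qQ] := quantile_bounded.
set m := u (q 0) 0; pose r := half_radius m.
have r0 : 0 < r by exact: half_radius_gt0.
have M0 : 0 <= M := density_bound_ge0 hu u0_le.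
have [M1 L1] : 0 < M + 1 /\ 0 < L + 1 by split; rewrite ltr_wpDl //.
pose tau := Num.min (m * r / (16 * (M + 1))) (m / (16 * (L + 1))).
have tau0 : 0 < tau.
  by rewrite lt_min; apply/andP; split; rewrite divr_gt0// mulr_gt0.
have [c c0 uc] := density_ge_late (exprn_gt0 2 tau0) Q0.
exists (Num.min c (m / 8)); first by rewrite lt_min c0 divr_gt0.
move=> t /[dup] tT /andP[t0 tleT]; have [taut|ttau] := leP (tau ^+ 2) t.
  by rewrite ge_min uc ?qQ// taut.
rewrite ge_min; apply/orP; right.
have st : Num.sqrt t <= tau.
  by rewrite -[leRHS]ger0_norm ?(ltW tau0)// -sqrtr_sqr ler_wsqrtr// ltW.
have : M * (2 * Num.sqrt (t - 0)) <= m * r / 8.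
  apply: (@le_trans _ _ ((M + 1) * (2 * (m * r / (16 * (M + 1)))))).
    apply: ler_pM; rewrite ?mulr_ge0 ?lerDl// subr0 ler_wpM2l//.
    by rewrite (le_trans st)// ge_min lexx.
  by rewrite le_eqVlt; apply/orP; left; apply/eqP; field; rewrite gt_eqF.
have : L * (2 * Num.sqrt (t - 0)) <= m / 8.
  apply: (@le_trans _ _ ((L + 1) * (2 * (m / (16 * (L + 1)))))).
    apply: ler_pM; rewrite ?mulr_ge0 ?lerDl// subr0 ler_wpM2l//.
    by rewrite (le_trans st)// ge_min lexx orbT.
  by rewrite le_eqVlt; apply/orP; left; apply/eqP; field; rewrite gt_eqF.
have := cdf_time_dist_le hB hu cu u0_le (q t) (lexx 0) t0.
have := density_time_dist_le hB hu cu L_ge0 u0_lip (q t) (lexx 0) t0.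
have um y : `|y - q 0| <= r -> m / 2 <= u y 0.
  by move=> yr; apply: (@density_ge_near 0 (q 0)).
have m20 : 0 <= m / 2 by rewrite divr_ge0// ltW.
have := cdf_separation hu cu (q t) (lexx 0) m20 (ltW r0) um.
rewrite (hq (lexx 0)) (hq t0) (distrC alpha) => sep ut Gt ub Gb.
have qtr : `|q t - q 0| <= r.
  rewrite leNgt; apply/negP => rq; move: sep; rewrite min_r ?(ltW rq)// => sep.
  have : 0 < m * r by rewrite mulr_gt0.
  lra.
have := um _ qtr; move: ut; rewrite ler_distl => /andP[]; lra.
Qed.

(** At time t, the point q s has level within O(sqrt (t - s)) of alpha, and near
    q t the distribution function has slope at least m / 2.  If the two
    quantiles are more than r apart, then sqrt (t - s) is bounded below and the
    boundedness of q suffices. *)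
Lemma quantile_holder : exists2 K : R, 0 <= K &
  forall s t : R, 0 <= s -> s <= t -> t <= T ->
  `|q t - q s| <= K * Num.sqrt (t - s).
Proof.
have [Q Q0 qQ] := quantile_bounded.
have [m m0 qm] := quantile_density_pos.
have M0 : 0 <= M := density_bound_ge0 hu u0_le.
pose r := half_radius m; have r0 : 0 < r by exact: half_radius_gt0.
have Qr0 : 0 <= 2 * Q / r by apply: divr_ge0; [exact: mulr_ge0|exact: ltW].
have k0 : 0 <= 4 * M / m by apply: divr_ge0; [exact: mulr_ge0|exact: ltW].
exists (4 * M / m * (1 + 2 * Q / r)); first by rewrite mulr_ge0// addr_ge0.
move=> s t s0 st tT; have t0 := le_trans s0 st.
have um y : `|y - q t| <= r -> m / 2 <= u y t.
  by move=> yr; apply: (@density_ge_near t (q t)) => //; rewrite qm// t0.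
have m20 : 0 <= m / 2 by rewrite divr_ge0// ltW.
have := cdf_separation hu cu (q s) t0 m20 (ltW r0) um.
rewrite (hq t0) -(hq s0) distrC => sep.
have := le_trans sep (cdf_time_dist_le hB hu cu u0_le (q s) s0 st).
set h := Num.sqrt (t - s); have h0 : 0 <= h by exact: sqrtr_ge0.
have -> : M * (2 * h) = m / 2 * (4 * M / m * h) by field; rewrite gt_eqF.
rewrite ler_pM2l ?divr_gt0// => mh.
rewrite mulrAC mulrDr mulr1.
have Mh0 : 0 <= 4 * M / m * h by rewrite mulr_ge0.
have [qr|rq] := leP `|q t - q s| r.
  by rewrite min_l// in mh; rewrite (le_trans mh)// lerDl mulr_ge0.
rewrite (min_r (ltW rq)) in mh.
have q2 : `|q t - q s| <= 2 * Q.
  rewrite (le_trans (ler_normB _ _))// mulr_natl mulr2n lerD// qQ//.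
    by rewrite t0.
  by rewrite s0 (le_trans st).
rewrite (le_trans q2)//.
apply: (@le_trans _ _ (r * (2 * Q / r))).
  by rewrite [leRHS]mulrC divfK// gt_eqF.
by rewrite (le_trans (ler_wpM2r Qr0 mh))// lerDr.
Qed.


Lemma measurable_crossing (s t : R) (x y : R) :
  measurable_fun setT (fun v : R => Num.max 0 (G s x - G s (y - v))).
Proof.
apply: measurable_maxr => //; apply: measurable_funB => //.
exact: measurable_rcdf_shift.
Qed.

Lemma crossing_integrand_itv (s x y v : R) :
  0 <= Num.max 0 (G s x - G s (y - v)) <= 1.
Proof.
rewrite le_max lexx/= ge_max ler01/=.
have := rcdf_ge0 (B s) (y - v); have := rcdf_le1 (B s) x; lra.
Qed.

(** A crossing with increment v confines B s to an interval of length at most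
    |q t - q s| + |v|. *)
Lemma crossing_prob_le : exists2 C : R, 0 < C & forall s t : R,
  0 <= s -> s < t -> t <= T ->
  fine (P [set w | B s w <= q s /\ q t < B t w]) <= C * Num.sqrt (t - s).
Proof.
have [K K0 qK] := quantile_holder.
have M0 : 0 <= M := density_bound_ge0 hu u0_le.
exists (M * (K + 2) + 1); first by rewrite ltr_wpDl// mulr_ge0// addr_ge0.
move=> s t s0 st tT; rewrite (joint_tail_evolution hB _ _ s0 st).
set h := Num.sqrt (t - s); have h0 : 0 <= h by exact: sqrtr_ge0.
apply: (@le_trans _ _ (M * (K * h) + M * (2 * h))); last first.
  by rewrite mulrDl mul1r; lra.
apply: (@Rintegral_le_affine _ _ _ _ _ 1) => [||v||v] //.
- exact: (brownian_increment_abs_moment hB s0 st).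
- exact: measurable_crossing.
- have /andP[k0 k1] := crossing_integrand_itv s (q s) (q t) v.
  by rewrite ger0_norm.
- rewrite ge_max addr_ge0 ?mulr_ge0//=.
  rewrite (le_trans (ler_norm _))//.
  rewrite (le_trans (cdf_lip hB hu cu u0_le _ _ s0))//.
  rewrite -mulrDr ler_wpM2l// opprB addrCA (le_trans (ler_normD _ _))//.
  by rewrite [leLHS]addrC lerD2r distrC qK// ltW.
Qed.

(** With h = sqrt (t - s), a crossing occurs when B s is within h below q s and
    the increment is between (K + 1) h and (K + 2) h: as q moves by at most
    K h, the increment covers the remaining distance.  The first event has
    probability of order h; the second one, by Brownian scaling, has a
    probability bounded below independently of h. *)
Lemma crossing_prob_ge : exists2 c : R, 0 < c & forall s t : R,
  0 <= s -> s < t -> t <= T ->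
  c * Num.sqrt (t - s) <= fine (P [set w | B s w <= q s /\ q t < B t w]).
Proof.
have [K K0 qK] := quantile_holder.
have [m m0 qm] := quantile_density_pos.
pose r := half_radius m; have r0 : 0 < r by exact: half_radius_gt0.
have sT0 : 0 < Num.sqrt T by rewrite sqrtr_gt0.
(* k * h is at most both h and r, for every h <= sqrt T *)
pose k := Num.min 1 (r / Num.sqrt T).
have k0 : 0 < k by rewrite lt_min ltr01 divr_gt0.
pose g := normal_peak 1 * expR (- (K + 2) ^+ 2 / 2) : R.
have g0 : 0 < g by rewrite mulr_gt0 ?expR_gt0// normal_peak_gt0// oner_eq0.
have m20 : 0 < m / 2 by rewrite divr_gt0.
exists (m / 2 * k * g); first by do 2!apply: mulr_gt0 => //.
move=> s t s0 st tT; rewrite (joint_tail_evolution hB _ _ s0 st).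
set h := Num.sqrt (t - s).
have h0 : 0 < h by rewrite sqrtr_gt0 subr_gt0.
have hT : h <= Num.sqrt T by rewrite ler_wsqrtr//; lra.
pose I := `[(K + 1) * h, (K + 2) * h]%classic : set R.
have um y : `|y - q s| <= r -> m / 2 <= u y s.
  move=> yr; apply: (@density_ge_near s (q s)) => //.
  by rewrite qm// s0/=; lra.
have khr : k * h <= Num.min h r.
  rewrite le_min; apply/andP; split.
    by rewrite ler_piMl ?(ltW h0)// ge_min lexx.
  apply: (@le_trans _ _ (r / Num.sqrt T * Num.sqrt T)).
    by apply: ler_pM; rewrite ?(ltW k0) ?(ltW h0)// ge_min lexx orbT.
  by rewrite divfK// gt_eqF.
apply: (@le_trans _ _ (m / 2 * Num.min h r * fine (nu s t I))); last first.
  apply: (@Rintegral_ge_indic _ _ _ 1) => [|v||v].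
  - exact: measurable_crossing.
  - exact: crossing_integrand_itv.
  - exact: measurable_itv.
  - rewrite /I/= in_itv/= => /andP[v1 _].
    have := cdf_separation hu cu (q s - h) s0 (ltW m20) (ltW r0) um.
    rewrite addrAC subrr add0r normrN (ger0_norm (ltW h0)) => /le_trans; apply.
    rewrite distrC ger0_norm; last first.
      by rewrite subr_ge0 rcdf_nondecreasing// gerBl ltW.
    rewrite le_max; apply/orP; right; rewrite lerB// rcdf_nondecreasing//.
    have := qK s t s0 (ltW st) tT; rewrite -/h ler_norml => /andP[_].
    by lra.
have gI : g <= fine (nu s t I).
  rewrite -lee_fin fineK ?fin_num_measure//; last exact: measurable_itv.
  apply: le_trans
    (brownian_increment_itv_ge (c := (K + 2) * h) hB s0 st _ _) => [||v].
  - rewrite lee_fin -mulrBl (_ : K + 2 - (K + 1) = 1) ?mul1r; last by ring.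
    rewrite -/h -[h in normal_peak h]mulr1 normal_peakM//.
    rewrite [leRHS]mulrA mulVKf ?gt_eqF//.
    rewrite ler_wpM2l ?normal_peak_ge0// ler_expR.
    rewrite -(sqr_sqrtr (_ : 0 <= t - s)) ?subr_ge0 ?(ltW st)// -/h.
    by rewrite le_eqVlt; apply/orP; left; apply/eqP; field; rewrite gt_eqF.
  - by rewrite ler_wpM2r ?(ltW h0)//; lra.
  - move=> /andP[v1 v2]; rewrite ger0_norm// (le_trans _ v1)//.
    by rewrite mulr_ge0 ?(ltW h0)// addr_ge0.
have -> : m / 2 * k * g * h = m / 2 * (k * h) * g by ring.
apply: ler_pM => //; rewrite ?(ltW g0)//.
  by rewrite mulr_ge0 ?(ltW m20)// mulr_ge0 ?(ltW k0) ?(ltW h0).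
by rewrite ler_wpM2l ?(ltW m20).
Qed.

End quantile_curve.

(** * Second moments of the increments *)

Section schwartz_bounds.
Context {R : realType} (f : R -> R).
Hypothesis hf : schwartz f.

Lemma schwartz_derive1n_bounded m : exists M, forall x, `|derive1n m f x| <= M.
Proof.
have [M hM] := hf.2 0%N m; exists M => x.
by apply: le_trans (hM x); rewrite expr0 ler_peMl// lerDl.
Qed.

Lemma schwartz_lip : exists2 L, 0 <= L &
  forall x y, `|f x - f y| <= L * `|x - y|.
Proof.
have [L hL] := schwartz_derive1n_bounded 1.
have L0 : 0 <= L := le_trans (normr_ge0 _) (hL 0).
exists L => // x y; wlog yx : x y / y <= x.
  by move=> H; have [/H//|/ltW/H] := leP y x; rewrite distrC [X in _ * X]distrC.
have df (z : R) : is_derive z 1 f (derive1n 1 f z).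
  by apply: DeriveDef; [exact: (hf.1 0%N)|rewrite -derive1E].
have [c _ ->] := derivable_mvt df yx.
by rewrite normrM ler_wpM2r.
Qed.

End schwartz_bounds.

Section second_moments.
Context d (Omega : measurableType d) (R : realType) (P : probability Omega R).
Variables X Y : {RV P >-> R}.
Variables a b c : R.
Hypothesis EXX : ('E_P[fun w => (X w * X w)%R] = a%:E)%E.
Hypothesis EYY : ('E_P[fun w => (Y w * Y w)%R] = b%:E)%E.
Hypothesis EXY : ('E_P[fun w => (X w * Y w)%R] = c%:E)%E.

Lemma integrable_sqr (Z : {RV P >-> R}) (z : R) :
  ('E_P[fun w => (Z w * Z w)%R] = z%:E)%E ->
  P.-integrable setT (EFin \o (fun w => Z w * Z w)).
Proof.
rewrite unlock => EZ; apply/integrableP; split.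
  by apply/measurable_EFinP; exact: measurable_funM.
rewrite (eq_integral (fun w => (Z w * Z w)%:E)) ?EZ ?ltry// => w _ /=.
by rewrite ger0_norm// -expr2 sqr_ge0.
Qed.

Lemma expectation_sqr_diff :
  ('E_P[fun w => (`|Y w - X w| ^+ 2)%R] = (a + b - 2 * c)%:E)%E.
Proof.
have iX := integrable_sqr EXX; have iY := integrable_sqr EYY.
have iXY : P.-integrable setT (EFin \o (fun w => X w * Y w)).
  apply: (le_integrable _ _ _ (integrableD measurableT iX iY)) => //.
    by apply/measurable_EFinP; exact: measurable_funM.
  move=> w _ /=; rewrite lee_fin [leRHS]ger0_norm; last first.
    by rewrite -!expr2 addr_ge0 ?sqr_ge0.
  have := sqr_ge0 (X w + Y w); have := sqr_ge0 (X w - Y w).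
  have := sqr_ge0 (X w); have := sqr_ge0 (Y w).
  rewrite ler_norml; nra.
have i2XY := integrableZl measurableT 2 iXY.
have := EXX; have := EYY; have := EXY; rewrite unlock => eXY eYY eXX.
rewrite (eq_integral (fun w =>
  ((X w * X w)%:E + (Y w * Y w)%:E - 2%:E * (X w * Y w)%:E)%E)).
  rewrite integralB//; last exact: integrableD.
  by rewrite integralD// integralZl// eXX eYY eXY.
move=> w _; rewrite -EFinM -EFinD; congr EFin.
by rewrite real_normK ?num_real//; ring.
Qed.

End second_moments.

Section increment_algebra.
Context {R : realFieldType}.

(** With us and ut the densities at the two quantiles and de the crossing
    probability, this is the second moment of the increment of
    (1{B <= q} - al) / u: the first term comes from the change of
    normalization, the second one from the crossings. *)
Lemma bernoulli_increment (al us ut de : R) : us != 0 -> ut != 0 ->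
  (al - al ^+ 2) / (us * us) + (al - al ^+ 2) / (ut * ut) -
    2 * ((al - de - al ^+ 2) / (us * ut)) =
  (al - al ^+ 2) * ((ut - us) / (us * ut)) ^+ 2 + 2 * de / (us * ut).
Proof. by move=> us0 ut0; field; rewrite us0 ut0. Qed.

Lemma increment_ge (al us ut de x M : R) : 0 <= al <= 1 -> 0 < us <= M ->
  0 < ut <= M -> 0 <= x -> x <= de ->
  2 * x / M ^+ 2 <=
  (al - al ^+ 2) * ((ut - us) / (us * ut)) ^+ 2 + 2 * de / (us * ut).
Proof.
move=> /andP[al0 al1] /andP[us0 usM] /andP[ut0 utM] x0 xde.
have M0 := lt_le_trans us0 usM.
rewrite -[leLHS]add0r lerD//.
  by rewrite mulr_ge0 ?sqr_ge0//; nra.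
apply: ler_pM; rewrite ?mulr_ge0 ?invr_ge0 ?sqr_ge0//.
  by rewrite ler_wpM2l.
rewrite lef_pV2 ?posrE ?mulr_gt0 ?exprn_gt0//.
by rewrite expr2 ler_pM// ltW.
Qed.

Lemma increment_le (al us ut de x y m : R) : 0 <= al <= 1 -> 0 < m ->
  m <= us -> m <= ut -> 0 <= de <= x -> `|ut - us| <= y ->
  (al - al ^+ 2) * ((ut - us) / (us * ut)) ^+ 2 + 2 * de / (us * ut) <=
  y ^+ 2 / m ^+ 4 + 2 * x / m ^+ 2.
Proof.
move=> /andP[al0 al1] m0 mus mut /andP[de0 dex] uy.
have us0 := lt_le_trans m0 mus; have ut0 := lt_le_trans m0 mut.
have V : (us * ut)^-1 <= (m ^+ 2)^-1.
  by rewrite lef_pV2 ?posrE ?mulr_gt0 ?exprn_gt0// expr2 ler_pM// ltW.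
have V0 : 0 <= (us * ut)^-1 by rewrite invr_ge0 mulr_ge0// ltW.
rewrite lerD//.
  apply: (@le_trans _ _ (1 * ((ut - us) / (us * ut)) ^+ 2)).
    by rewrite ler_wpM2r ?sqr_ge0//; nra.
  rewrite mul1r exprMn ler_pM ?sqr_ge0//.
    rewrite -(real_normK (num_real (ut - us))).
    by rewrite lerXn2r ?nnegrE// (le_trans _ uy).
  rewrite (_ : (m ^+ 4)^-1 = (m ^+ 2)^-1 ^+ 2); last by field; rewrite gt_eqF.
  by rewrite lerXn2r// nnegrE// (le_trans V0).
by apply: ler_pM; rewrite ?mulr_ge0// ler_wpM2l.
Qed.

End increment_algebra.

Lemma quantile_covE d (Omega : measurableType d) (R : realType)
    (P : probability Omega R) (B : R -> {RV P >-> R}) (alpha : R)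
    (u : R -> R -> R) (q : R -> R) (s t : R) :
  rcdf (B s) (q s) = alpha ->
  quantile_cov B alpha u q s t =
  (alpha - fine (P [set w | B s w <= q s /\ q t < B t w]) - alpha ^+ 2) /
  (u (q s) s * u (q t) t).
Proof.
move=> qs; rewrite /quantile_cov; congr ((_ - _) / _).
have mB (r : R) (I : interval R) : measurable [set w | B r w \in I].
  exact: (@measurable_funPTI _ _ _ _ (B r) [set` I]).
have mX : measurable [set w | B s w <= q s /\ B t w <= q t].
  exact: measurableI (mB s `]-oo, q s]) (mB t `]-oo, q t]).
have mY : measurable [set w | B s w <= q s /\ q t < B t w].
  rewrite (_ : mkset _ = [set w | B s w \in `]-oo, q s]] `&`
      [set w | B t w \in `]q t, +oo[]); first exact: measurableI.
  by apply/seteqP; split => w /=; rewrite !in_itv/= andbT.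
rewrite -qs; apply/eqP; rewrite eq_sym subr_eq; apply/eqP.
rewrite /rcdf -fineD ?fin_num_measure//; congr fine.
rewrite /cdf /distribution /pushforward -measureU//.
  congr (P _); apply/seteqP; split => w /=; rewrite in_itv/=.
    by move=> ws; have [wt|wt] := leP (B t w) (q t); [left|right].
  by case=> -[].
by apply/seteqP; split => w //= -[[_ h1] [_]]; rewrite ltNge h1.
Qed.

Theorem corollary3p2 (R : realType) (alpha : R)
    (halpha0 : 0 < alpha) (halpha1 : alpha < 1)
    (d : measure_display) (Omega : measurableType d)
    (P : probability Omega R)
    (B W : R -> {RV P >-> R})
    (hB : brownian_motion_random_start B W)
    (f : R -> R) (hf : schwartz f) (hB0 : has_density (B 0) f)
    (u : R -> R -> R)
    (hu : forall t : R, 0 <= t -> has_density (B t) (fun x => u x t))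
    (hu_cont : forall t : R, 0 <= t -> continuous (fun x => u x t))
    (hu0 : forall x : R, u x 0 = f x)
    (q : R -> R)
    (hq0 : (\int[lebesgue_measure]_(x in `]-oo, (q 0)%R]) (f x)%:E)%E
           = alpha%:E)
    (hq0_unique : forall y : R,
       (\int[lebesgue_measure]_(x in `]-oo, y]) (f x)%:E)%E = alpha%:E ->
       y = q 0)
    (hfq0 : 0 < f (q 0))
    (hq : forall t : R, 0 < t -> cdf (B t) (q t) = alpha%:E)
    (dF : measure_display) (OmegaF : measurableType dF)
    (PF : probability OmegaF R)
    (F : R -> {RV PF >-> R})
    (hF : centered_gaussian_process_cov F (quantile_cov B alpha u q))
    (hF_paths : continuous_paths F)
    (T : R) (hT : 0 < T) :
  exists C1 C2 : R, [/\ 0 < C1, 0 < C2 &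
    forall s t : R, 0 <= s <= T -> 0 <= t <= T ->
      ((C1 * `|t - s| `^ (1 / 2))%:E
         <= 'E_PF[fun w => (`|F t w - F s w| ^+ 2)%R])%E /\
      ('E_PF[fun w => (`|F t w - F s w| ^+ 2)%R]
         <= (C2 * `|t - s| `^ (1 / 2))%:E)%E].
Proof.
have [[M hM] [L L0 fL]] := (schwartz_derive1n_bounded hf 0, schwartz_lip hf).
have u0_le x : u x 0 <= M.
  by rewrite hu0; apply: le_trans (hM x); exact: ler_norm.
have u0_lip x y : `|u x 0 - u y 0| <= L * `|x - y| by rewrite !hu0.
have uq0 : 0 < u (q 0) 0 by rewrite hu0.
have qt (t : R) : 0 <= t -> rcdf (B t) (q t) = alpha.
  rewrite le_eqVlt => /predU1P[<-|t0]; last by rewrite /rcdf hq.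
  have [_ _ h] := hB0; rewrite /rcdf /cdf h//.
  by rewrite hq0.
have [m m0 um] := quantile_density_pos hB hu hu_cont u0_le L0 u0_lip
  halpha0 halpha1 hT qt uq0.
have [K K0 qK] := quantile_holder hB hu hu_cont u0_le L0 u0_lip
  halpha0 halpha1 hT qt uq0.
have [C C0 deC] := crossing_prob_le hB hu hu_cont u0_le L0 u0_lip
  halpha0 halpha1 hT qt uq0.
have [c c0 dec] := crossing_prob_ge hB hu hu_cont u0_le L0 u0_lip
  halpha0 halpha1 hT qt uq0.
have M0 : 0 < M := lt_le_trans uq0 (u0_le _).
pose D := L * (K + 2).
have D0 : 0 <= D by rewrite mulr_ge0// addr_ge0.
exists (2 * c / M ^+ 2), (D ^+ 2 * Num.sqrt T / m ^+ 4 + 2 * C / m ^+ 2); split.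
- by rewrite divr_gt0 ?exprn_gt0// mulr_gt0.
- rewrite ltr_wpDl//.
    by rewrite divr_ge0 ?exprn_ge0 ?(ltW m0)// mulr_ge0 ?sqr_ge0.
  by rewrite divr_gt0 ?exprn_gt0// mulr_gt0.
have powE (x : R) : 0 <= x -> x `^ (1 / 2) = Num.sqrt x.
  by move=> x0; rewrite div1r powR12_sqrt.
(* the second moment is symmetric in s and t, and 0 when they agree *)
suff main (s t : R) : 0 <= s -> s < t -> t <= T -> exists v,
    [/\ ('E_PF[fun w => (`|F t w - F s w| ^+ 2)%R] = v%:E)%E,
      2 * c / M ^+ 2 * Num.sqrt (t - s) <= v &
      v <= (D ^+ 2 * Num.sqrt T / m ^+ 4 + 2 * C / m ^+ 2) * Num.sqrt (t - s)].
  move=> s t /andP[s0 sT] /andP[t0 tT]; rewrite powE//.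
  have [st|ts|<-] := ltgtP s t.
  - have [v [-> v1 v2]] := main s t s0 st tT.
    by rewrite ger0_norm ?subr_ge0 ?(ltW st)// !lee_fin.
  - have [v [vE v1 v2]] := main t s t0 ts sT.
    rewrite ltr0_norm ?subr_lt0// opprB.
    under eq_fun do rewrite distrC.
    by rewrite vE !lee_fin.
  - rewrite subrr normr0 sqrtr0 !mulr0.
    have -> : (fun w => `|F s w - F s w| ^+ 2) = cst 0.
      by apply/funext => w; rewrite subrr normr0 expr0n.
    by rewrite expectation_cst.
move=> s0 st tT; have t0 := le_trans s0 (ltW st).
have sT := le_trans (ltW st) tT.
set h := Num.sqrt (t - s); have h0 : 0 <= h by exact: sqrtr_ge0.
have ms : m <= u (q s) s by rewrite um ?s0.
have mt : m <= u (q t) t by rewrite um ?t0.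
have us0 := lt_le_trans m0 ms; have ut0 := lt_le_trans m0 mt.
have usM : u (q s) s <= M := density_le hB hu hu_cont u0_le _ s0.
have utM : u (q t) t <= M := density_le hB hu hu_cont u0_le _ t0.
set de := fine (P [set w | B s w <= q s /\ q t < B t w]).
have vE := expectation_sqr_diff (cgp_cov hF s0 s0) (cgp_cov hF t0 t0)
  (cgp_cov hF s0 t0).
(* the variances correspond to an empty crossing event *)
have de0 (r : R) : [set w | B r w <= q r /\ q r < B r w] = set0.
  by apply/seteqP; split => w //= -[h1]; rewrite ltNge h1.
have al01 : 0 <= alpha <= 1 by rewrite !ltW.
rewrite !quantile_covE ?qt// !de0 measure0 subr0 -/de in vE.
rewrite bernoulli_increment ?gt_eqF// in vE.
eexists; split; first exact: vE.
- have -> : 2 * c / M ^+ 2 * h = 2 * (c * h) / M ^+ 2 by rewrite mulrAC mulrA.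
  apply: increment_ge => //; rewrite ?us0 ?ut0 ?mulr_ge0 ?(ltW c0)//.
  exact: dec.
- have uy : `|u (q t) t - u (q s) s| <= D * h.
    have -> : u (q t) t - u (q s) s =
      (u (q t) t - u (q s) t) + (u (q s) t - u (q s) s) by ring.
    apply: (le_trans (ler_normD _ _)).
    have := density_lip hB hu hu_cont u0_lip (q t) (q s) t0.
    have := density_time_dist_le hB hu hu_cont L0 u0_lip (q s) s0 (ltW st).
    have := ler_wpM2l L0 (qK s t s0 (ltW st) tT).
    rewrite -/h /D; lra.
  have xde : 0 <= de <= C * h by rewrite deC// andbT fine_ge0.
  apply: (le_trans (increment_le al01 m0 ms mt xde uy)).
  rewrite [leRHS]mulrDl lerD//; last by rewrite [leRHS]mulrAC mulrA.
  rewrite [leRHS]mulrAC ler_wpM2r ?invr_ge0 ?exprn_ge0 ?(ltW m0)//.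
  rewrite exprMn -[leRHS]mulrA ler_wpM2l ?sqr_ge0// (expr2 h) ler_wpM2r//.
  by rewrite ler_wsqrtr//; lra.
Qed.
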